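(* Let $n\ge 1$, let $\lambda\in[0,1]$ and let $p$ be a nonzero real number. Let $A=[\langle a_{ij\mu},a_{ij\nu}\rangle]$ be an intuitionistic fuzzy matrix of order $n$, and let $A^m$ denote its $m$-th maxgeneralized mean-mingeneralized mean power (defined below). Then for every integer $m\ge 1$ and all $1\le i,j\le n$, $$[A^m]_{ij}=\Big\langle \max_{P} w_\mu(P),\ \min_{P} w_\nu(P)\Big\rangle ,$$ where the maximum and the minimum are taken over all $m$-paths $P$ from vertex $i$ to vertex $j$.
   Context: An intuitionistic fuzzy matrix (IFM) of order $n$ is an $n\times n$ matrix $A=[a_{ij}]$ whose entries are pairs $a_{ij}=\langle a_{ij\mu},a_{ij\nu}\rangle$ of real numbers with $a_{ij\mu},a_{ij\nu}\in[0,1]$ and $a_{ij\mu}+a_{ij\nu}\le 1$ (membership and non-membership values). For IFMs $A,B$ of order $n$, the maxgeneralized mean-mingeneralized mean product is $$[A\circ B]_{ij}=\Big\langle \max_{1\le t\le n}\big(\lambda a_{it\mu}^p+(1-\lambda)b_{tj\mu}^p\big)^{1/p},\ \min_{1\le t\le n}\big(\lambda a_{it\nu}^p+(1-\lambda)b_{tj\nu}^p\big)^{1/p}\Big\rangle .$$ Powers are defined by $A^1=A$ and $A^k=A^{k-1}\circ A$ for $k\ge 2$. Consider the complete directed graph on vertex set $\{1,\dots,n\}$ (all ordered pairs, including loops, are edges), the edge $(i,j)$ carrying the value $a_{ij}$. An $m$-path from $i$ to $j$ is a sequence of $m$ edges $(i_0,i_1),(i_1,i_2),\dots,(i_{m-1},i_m)$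 with $i_0=i$, $i_m=j$ (vertices may repeat). Its weight is $w(P)=\langle w_\mu(P),w_\nu(P)\rangle$ with $$w_\mu(P)=\Big(\sum_{l=1}^m c_l\,a_{i_{l-1}i_l\mu}^p\Big)^{1/p},\qquad w_\nu(P)=\Big(\sum_{l=1}^m c_l\,a_{i_{l-1}i_l\nu}^p\Big)^{1/p},$$ where $c_1=\lambda^{m-1}$ and $c_l=\lambda^{m-l}(1-\lambda)$ for $2\le l\le m$, i.e. $w_\mu(P)=(\lambda^{m-1}a_{i_0i_1\mu}^p+\lambda^{m-2}(1-\lambda)a_{i_1i_2\mu}^p+\dots+(1-\lambda)a_{i_{m-1}i_m\mu}^p)^{1/p}$ (for $m=1$, $w(P)=a_{i_0i_1}$). Conventions: $0^0=1$; when $p<0$, $0^p=+\infty$, $c\cdot(+\infty)=+\infty$ for $c>0$, $0\cdot(+\infty)=0$, $x+(+\infty)=+\infty$, and $(+\infty)^{1/p}=0$. *)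

(* Defs.v *)
From HB Require Import structures.
From mathcomp Require Import all_boot all_order all_algebra.
From mathcomp Require Import all_classical all_reals all_analysis.

Set Implicit Arguments.
Unset Strict Implicit.
Unset Printing Implicit Defensive.

Import Order.TTheory GRing.Theory Num.Theory.
Local Open Scope ring_scope.

(* Real powers on [0, +oo] with 0 ^ r = +oo and +oo ^ r = 0 for r < 0.
   The library's [poweR] differs there (0 `^ r = 0 and +oo `^ r = +oo), so
   negative exponents go through [inve], for which 0^-1 = +oo and
   +oo^-1 = 0. *)
Definition xpow (R : realType) (x : \bar R) (r : R) : \bar R :=
  (if (0 <= r)%R then x `^ r else (x `^ (- r)%R)^-1)%E.

(* Maximum and minimum of finitely many reals. The fold is done in \bar R,
   where -oo and +oo are neutral; [fine] returns the real value whenever some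
   index satisfies P. *)
Definition maxR (R : realType) (I : finType) (P : pred I) (F : I -> R) : R :=
  fine (\big[maxe/-oo%E]_(i | P i) (F i)%:E).

Definition minR (R : realType) (I : finType) (P : pred I) (F : I -> R) : R :=
  fine (\big[mine/+oo%E]_(i | P i) (F i)%:E).

(* An entry is a pair (membership, non-membership). *)
Definition is_ifm (R : realType) (n : nat) (A : 'M[R * R]_n) : Prop :=
  forall i j, [/\ 0 <= (A i j).1 <= 1, 0 <= (A i j).2 <= 1 &
                  (A i j).1 + (A i j).2 <= 1].

Definition gmean (R : realType) (lam p x y : R) : R :=
  fine (xpow (lam%:E * xpow x%:E p + (1 - lam)%:E * xpow y%:E p)%E p^-1).

Definition ifm_mul (R : realType) (lam p : R) (n : nat) (A B : 'M[R * R]_n) :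
    'M[R * R]_n :=
  \matrix_(i, j) (maxR xpredT (fun t => gmean lam p (A i t).1 (B t j).1),
                  minR xpredT (fun t => gmean lam p (A i t).2 (B t j).2)).

(* A^1 = A and A^k = A^(k-1) o A for k >= 2; the value A at k = 0 is junk. *)
Definition ifm_pow (R : realType) (lam p : R) (n : nat) (A : 'M[R * R]_n)
    (k : nat) : 'M[R * R]_n :=
  iter k.-1 (fun B => ifm_mul lam p B A) A.

(* An m-path (i_0,i_1), ..., (i_(m-1),i_m) is given by its vertices
   i_0, ..., i_m; the graph is complete with loops, so any sequence is allowed. *)
Definition is_mpath (n m : nat) (i j : 'I_n) (v : {ffun 'I_m.+1 -> 'I_n}) :
    bool :=
  (v ord0 == i) && (v ord_max == j).

Definition path_coef (R : realType) (lam : R) (m l : nat) : R :=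
  if l == 1%N then lam ^+ (m - 1) else lam ^+ (m - l) * (1 - lam).

(* [inord l] is the index l, since l <= m throughout the sum. *)
Definition path_weight (R : realType) (lam p : R) (n m : nat)
    (a : 'I_n -> 'I_n -> R) (v : {ffun 'I_m.+1 -> 'I_n}) : R :=
  fine (xpow (\sum_(1 <= l < m.+1)
                (path_coef lam m l)%:E
                * xpow (a (v (inord l.-1)) (v (inord l)))%:E p)%E p^-1).

Definition weight_mu (R : realType) (lam p : R) (n m : nat) (A : 'M[R * R]_n)
    (v : {ffun 'I_m.+1 -> 'I_n}) : R :=
  path_weight lam p (fun i j => (A i j).1) v.

Definition weight_nu (R : realType) (lam p : R) (n m : nat) (A : 'M[R * R]_n)
    (v : {ffun 'I_m.+1 -> 'I_n}) : R :=
  path_weight lam p (fun i j => (A i j).2) v.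

(* Main.v *)
(** Write g(x, y) for the generalized mean. On [0, 1] it satisfies
    g(x, y)^p = lam x^p + (1 - lam) y^p, also for p < 0 with 0^p = +oo: both
    sides stay in the image of [0, 1] under t |-> t^p, which is convex and on
    which the p-th root is an inverse. Hence path weights obey the recursion
    w(P e) = g(w(P), a_e). As g is monotone in its first argument, extending an
    extremal (m-1)-path to the best intermediate vertex gives an extremal
    m-path, which is the recursion defining the matrix power. *)
Require Import Defs.
From HB Require Import structures.
From mathcomp Require Import all_boot all_order all_algebra.
From mathcomp Require Import all_classical all_reals all_analysis.

Set Implicit Arguments.
Unset Strict Implicit.
Unset Printing Implicit Defensive.

Import Order.TTheory GRing.Theory Num.Theory.
Local Open Scope ring_scope.

(** * Inversion and monotonicity of real powers on [[0, +oo]] *)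

Section ExtendedPower.
Variable R : realType.
Implicit Types (x y : \bar R) (r s : R).
Local Open Scope ereal_scope.

Lemma poweR_inve x s : 0 <= x -> (0 < s)%R -> x^-1 `^ s = (x `^ s)^-1.
Proof.
move=> x0 s0; have sn0 : s != 0%R by rewrite gt_eqF.
case: x x0 => [x| |] //; last by rewrite invey poweRyr// poweR0r// invey.
rewrite lee_fin => x0; rewrite poweR_EFin inver.
have [->|xn0] := eqVneq x 0%R; first by rewrite powR0// inve0 poweRyr.
rewrite poweR_EFin inver powR_eq0 (negbTE xn0)/= -(powR_inv1 x0).
by rewrite -powRrM mulN1r powRN.
Qed.

Lemma xpow_ge0 x r : 0 <= x -> 0 <= xpow x r.
Proof. by move=> x0; rewrite /xpow; case: ifP; rewrite ?inve_ge0 poweR_ge0. Qed.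

Lemma xpow1 r : xpow 1 r = 1.
Proof. by rewrite /xpow; case: ifP; rewrite poweR1r ?inve1. Qed.

(** For [r < 0], inversion commutes with the positive power [- r^-1], so the two inversions cancel
    and the exponents multiply to 1; the endpoints 0 and [+oo] are included. *)
Lemma xpowK x r : 0 <= x -> r != 0%R -> xpow (xpow x r) r^-1 = x.
Proof.
move=> x0 rn0; rewrite /xpow invr_ge0; have [r0|r0] := leP 0%R r.
  by rewrite -poweRrM mulfV// poweRe1.
rewrite poweR_inve ?poweR_ge0//; last first.
  by rewrite oppr_gt0 invr_lt0.
by rewrite inveK -poweRrM mulrNN mulfV// poweRe1.
Qed.

Lemma le_xpow x y r : (0 <= r)%R -> 0 <= x -> x <= y -> xpow x r <= xpow y r.
Proof.
move=> r0 x0 xy; rewrite /xpow r0; apply: gt0_ler_poweR => //.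
  by rewrite in_itv/= x0 leey.
by rewrite in_itv/= (le_trans x0 xy) leey.
Qed.

Lemma ge_xpow x y r : (r < 0)%R -> 0 <= x -> x <= y -> xpow y r <= xpow x r.
Proof.
move=> r0 x0 xy; have Nr0 : (0 <= - r)%R by rewrite oppr_ge0 ltW.
rewrite /xpow (lt_geF r0) lee_pV2 ?inE ?poweR_ge0//.
by have := le_xpow Nr0 x0 xy; rewrite /xpow Nr0.
Qed.

End ExtendedPower.

(** * The generalized mean on [[0, 1]] and its p-th power *)

Section GeneralizedMean.
Variables (R : realType) (lam p : R).
Hypotheses (lam01 : 0 <= lam <= 1) (p_neq0 : p != 0).
Implicit Types (x y z : R) (S T : \bar R).

(* The image of [0, 1] under t |-> t ^ p, namely [0, 1] or [1, +oo]. *)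
Definition unit_power S : bool :=
  if 0 <= p then (0 <= S <= 1)%E else (1 <= S)%E.

Lemma unit_power_ge0 S : unit_power S -> (0 <= S)%E.
Proof.
by rewrite /unit_power; case: ifP => _; [case/andP | exact: le_trans].
Qed.

Lemma unit_power_xpow x : 0 <= x <= 1 -> unit_power (xpow x%:E p).
Proof.
move=> /andP[x0 x1]; rewrite /unit_power; have [p0|p0] := leP 0 p.
  by rewrite xpow_ge0//= -[leRHS](xpow1 p) le_xpow.
by rewrite -(xpow1 p) ge_xpow.
Qed.

Lemma unit_power_inv S : unit_power S -> (0 <= xpow S p^-1 <= 1)%E.
Proof.
move=> US; have S0 := unit_power_ge0 US; rewrite xpow_ge0//=.
rewrite -(xpow1 p^-1); move: US; rewrite /unit_power.
have [p0 /andP[_ S1]|p0 S1] := leP 0 p; first by rewrite le_xpow ?invr_ge0.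
by rewrite ge_xpow ?invr_lt0.
Qed.

(** The root lies in [[0, 1]], so [fine] never meets an infinite value. *)
Lemma fineK_unit_power S : unit_power S ->
  (fine (xpow S p^-1))%:E = xpow S p^-1.
Proof.
move=> /unit_power_inv/andP[S0 S1]; rewrite fineK// ge0_fin_numE//.
exact: le_lt_trans S1 (ltey 1).
Qed.

Lemma fine_unit_power S : unit_power S -> 0 <= fine (xpow S p^-1) <= 1.
Proof.
by move=> US; rewrite -!lee_fin fineK_unit_power// unit_power_inv.
Qed.

Lemma xpow_fineK S : unit_power S -> xpow (fine (xpow S p^-1))%:E p = S.
Proof.
move=> US; rewrite fineK_unit_power//.
have pV_neq0 : p^-1 != 0 by rewrite invr_eq0.
by have := xpowK (unit_power_ge0 US) pV_neq0; rewrite invrK.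
Qed.

Lemma onem_lam_ge0 : 0 <= 1 - lam.
Proof. by case/andP: lam01 => _; rewrite subr_ge0. Qed.

Lemma unit_power_conv S T : unit_power S -> unit_power T ->
  unit_power (lam%:E * S + (1 - lam)%:E * T)%E.
Proof.
move=> US UT; have := unit_power_ge0 US; have := unit_power_ge0 UT.
move: US UT => + + T0 S0; have l1 := onem_lam_ge0; have /andP[l0 _] := lam01.
(* Writing the bound 1 with the same weights reduces the comparison to one term at a time. *)
have E : 1%E = (lam%:E * 1 + (1 - lam)%:E * 1)%E :> \bar R.
  by rewrite !mule1 -EFinD addrC subrK.
rewrite /unit_power; case: ifP => _ => [/andP[_ S1] /andP[_ T1]|S1 T1].
  rewrite adde_ge0 ?mule_ge0 ?lee_fin//= [leRHS]E.
  by rewrite leeD// lee_wpmul2l.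
by rewrite [leLHS]E leeD// lee_wpmul2l.
Qed.

Lemma gmean_itv x y : 0 <= x <= 1 -> 0 <= y <= 1 -> 0 <= gmean lam p x y <= 1.
Proof.
by move=> x01 y01; rewrite fine_unit_power ?unit_power_conv ?unit_power_xpow.
Qed.

Lemma xpow_gmean x y : 0 <= x <= 1 -> 0 <= y <= 1 ->
  xpow (gmean lam p x y)%:E p =
  (lam%:E * xpow x%:E p + (1 - lam)%:E * xpow y%:E p)%E.
Proof.
by move=> x01 y01; rewrite xpow_fineK ?unit_power_conv ?unit_power_xpow.
Qed.

(** For [p < 0] both the power and the root reverse the order, so their composite still preserves
    it. *)
Lemma le_gmean x y z : 0 <= x <= 1 -> 0 <= y <= 1 -> 0 <= z <= 1 ->
  x <= y -> gmean lam p x z <= gmean lam p y z.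
Proof.
move=> x01 y01 z01 xy.
have Ux := unit_power_conv (unit_power_xpow x01) (unit_power_xpow z01).
have Uy := unit_power_conv (unit_power_xpow y01) (unit_power_xpow z01).
have /andP[l0 _] := lam01; have /andP[x0 _] := x01.
rewrite -lee_fin !fineK_unit_power//; have [p0|p0] := leP 0 p.
  rewrite le_xpow ?invr_ge0 ?unit_power_ge0//.
  by rewrite leeD2r// lee_wpmul2l ?lee_fin// le_xpow.
rewrite ge_xpow ?invr_lt0 ?unit_power_ge0//.
by rewrite leeD2r// lee_wpmul2l ?lee_fin// ge_xpow.
Qed.

End GeneralizedMean.

(** * Recursion for path weights and their extrema *)

Section Walks.
Variables (R : realType) (lam p : R) (n : nat) (a : 'I_n -> 'I_n -> R).
Hypotheses (lam01 : 0 <= lam <= 1) (p_neq0 : p != 0).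
Hypothesis a01 : forall i j, 0 <= a i j <= 1.
Implicit Types (u : nat -> 'I_n) (m : nat) (i j t : 'I_n).

(** Vertices are indexed by [nat], so a prefix of a walk is the same function [u]. The value at
    [m = 0] is junk, chosen inside [[0, 1]]. *)
Fixpoint walk_weight u m : R :=
  if m is m'.+1 then
    if m' == 0%N then a (u 0%N) (u 1%N)
    else gmean lam p (walk_weight u m') (a (u m') (u m))
  else 0.

Lemma walk_weight_itv u m : 0 <= walk_weight u m <= 1.
Proof.
elim: m => [|m IH] /=; first by rewrite lexx ler01.
by case: ifP => _ //; exact: gmean_itv.
Qed.

Lemma eq_walk_weight u u' m : (forall k, (k <= m)%N -> u k = u' k) ->
  walk_weight u m = walk_weight u' m.
Proof.
elim: m => [//|m IH] uu' /=; case: ifP => [/eqP m0|_].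
  by rewrite !uu' ?m0.
by rewrite IH ?uu'// => k km; rewrite uu'// ltnW.
Qed.

Lemma path_coefS m l : (0 < m)%N -> (l <= m)%N ->
  path_coef lam m.+1 l = lam * path_coef lam m l.
Proof.
move=> m0 lm; rewrite /path_coef; case: ifP => _.
  by rewrite subn1/= -exprS subn1 prednK.
by rewrite subSn// exprS mulrA.
Qed.

Lemma path_coef_ge0 m l : 0 <= path_coef lam m l.
Proof.
have /andP[l0 _] := lam01; rewrite /path_coef; case: ifP => _.
  exact: exprn_ge0.
by rewrite mulr_ge0 ?exprn_ge0 ?onem_lam_ge0.
Qed.

(** Appending an edge multiplies every earlier coefficient by [lam] and gives the new edge the
    coefficient [1 - lam]. *)
Lemma xpow_walk_weight u m : (0 < m)%N ->
  xpow (walk_weight u m)%:E p =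
  (\sum_(1 <= l < m.+1) (path_coef lam m l)%:E * xpow (a (u l.-1) (u l))%:E p)%E.
Proof.
elim: m => [//|[|m] IH] _; first by rewrite big_nat1 /path_coef/= expr0 mul1e.
rewrite -[LHS]/(xpow (gmean lam p (walk_weight u m.+1) _)%:E p).
rewrite xpow_gmean ?walk_weight_itv// IH// [RHS]big_nat_recr//=; congr (_ + _)%E.
  (* Nonnegativity of the terms justifies distributing [lam] over a sum that may be infinite. *)
  rewrite ge0_sume_distrr => [|l _]; last first.
    rewrite mule_ge0 ?lee_fin ?path_coef_ge0// xpow_ge0// lee_fin.
    by case/andP: (a01 (u l.-1) (u l)).
  apply: eq_big_nat => l /andP[_ lm].
  by rewrite muleA -EFinM -path_coefS.
by rewrite /path_coef/= subnn expr0 mul1r.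
Qed.

Lemma path_weightE m (v : {ffun 'I_m.+1 -> 'I_n}) : (0 < m)%N ->
  path_weight lam p a v = walk_weight (fun k => v (inord k)) m.
Proof.
move=> m0; rewrite /path_weight -xpow_walk_weight// xpowK//.
by rewrite lee_fin; case/andP: (walk_weight_itv (fun k => v (inord k)) m).
Qed.

(* [r] is instantiated with [<=] for memberships and [>=] for
   non-memberships. *)
Definition is_extremum (r : rel R) (I : Type) (P : I -> Prop) (F : I -> R) x :=
  (exists2 k, P k & F k = x) /\ (forall k, P k -> r (F k) x).

(** [b m] stands for one component of row [i] of the power [m.+1]; the abstract order [r] lets one
    induction serve both components. *)
Lemma walk_weight_extremum (r : rel R) (b : nat -> 'I_n -> R) i :
    reflexive r -> transitive r ->
    (forall x y z, 0 <= x <= 1 -> 0 <= y <= 1 -> 0 <= z <= 1 ->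
      r x y -> r (gmean lam p x z) (gmean lam p y z)) ->
    (forall j, b 0%N j = a i j) ->
    (forall m j, is_extremum r (fun=> true)
      (fun t => gmean lam p (b m t) (a t j)) (b m.+1 j)) ->
  forall m j, is_extremum r (fun u => u 0%N = i /\ u m.+1 = j)
    (walk_weight^~ m.+1) (b m j).
Proof.
move=> r_refl r_trans r_gmean b0 bS; elim=> [|m IH] j.
  rewrite b0; split=> [|u [<- <-]] //=.
  by exists (fun k => if k == 0%N then i else j).
split=> [|u [u0 uj]].
  have [[t _ <-] _] := bS m j; have [[u [u0 ut] <-] _] := IH t.
  (* An extremal walk to the best intermediate vertex [t], followed by the edge to [j]. *)
  exists (fun k => if (k <= m.+1)%N then u k else j); first by rewrite /= ltnn.
  rewrite -[LHS]/(gmean lam p (walk_weight _ m.+1) (a _ _)) ltnn leqnn ut.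
  by rewrite (@eq_walk_weight _ u) // => k ->.
rewrite -[walk_weight _ _]/(gmean lam p (walk_weight u m.+1)
  (a (u m.+1) (u m.+2))).
have [_ /(_ _ isT)] := bS m j; move=> /(_ (u m.+1)); apply: r_trans.
(* [bP] bounds the prefix of [u]; the attaining walk [u'] places [b m (u m.+1)] in [[0, 1]], as
   [r_gmean] requires. *)
have [[u' _ b_u'] bP] := IH (u m.+1).
rewrite uj; apply: r_gmean => //; first exact: walk_weight_itv.
  by rewrite -b_u' walk_weight_itv.
exact: bP.
Qed.

(** Only the vertices [0] to [m] affect the weight, so walks on [nat] and finite vertex sequences
    attain the same values. *)
Lemma path_weight_extremum (r : rel R) m i j x : (0 < m)%N ->
    is_extremum r (fun u => u 0%N = i /\ u m = j) (walk_weight^~ m) x ->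
  is_extremum r (fun v => is_mpath i j v) (@path_weight R lam p n m a) x.
Proof.
move=> m0 [[u [u0 um] ux] u_ext]; split=> [|v /andP[/eqP v0 /eqP vm]].
  exists [ffun k : 'I_m.+1 => u k].
    by rewrite /is_mpath !ffunE u0 um !eqxx.
  rewrite path_weightE// -ux; apply: eq_walk_weight => k km.
  by rewrite ffunE inordK.
rewrite path_weightE//; apply: u_ext; split.
  by rewrite -v0; congr (v _); apply: val_inj; rewrite /= inordK.
by rewrite -vm; congr (v _); apply: val_inj; rewrite /= inordK.
Qed.

End Walks.

(** * Finite maxima and minima as attained bounds *)

Section Extrema.
Variables (R : realType) (I : finType).
Implicit Types (P : pred I) (F : I -> R).

(** The witness [k] excludes the empty fold, where [fine] would turn [-oo] into 0; a nonempty finite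
    family attains its maximum. *)
Lemma maxRP P F x : is_extremum <=%R P F x <-> (exists k, P k) /\ maxR P F = x.
Proof.
have maxE y : is_extremum <=%R P F y -> maxR P F = y.
  move=> [[k Pk <-] F_le]; rewrite /maxR.
  suff -> : \big[maxe/-oo%E]_(i | P i) (F i)%:E = (F k)%:E by [].
  apply/eqP; rewrite eq_le (le_bigmax_cond _ (fun i => (F i)%:E) Pk) andbT.
  by apply/bigmax_leP; split=> [|i Pi]; rewrite ?leNye// lee_fin F_le.
split=> [ext|[[k Pk] <-]].
  by split; [have [[k]] := ext; exists k|exact: maxE].
case: (@arg_maxP _ _ _ k P F Pk) => l Pl F_le.
have ext : is_extremum <=%R P F (F l) by split; [exists l|].
by rewrite (maxE _ ext).
Qed.

Lemma minRP P F x : is_extremum >=%R P F x <-> (exists k, P k) /\ minR P F = x.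
Proof.
have minE y : is_extremum >=%R P F y -> minR P F = y.
  move=> [[k Pk <-] F_ge]; rewrite /minR.
  suff -> : \big[mine/+oo%E]_(i | P i) (F i)%:E = (F k)%:E by [].
  apply/eqP; rewrite eq_le (bigmin_le_cond _ (fun i => (F i)%:E) Pk)/=.
  by apply/bigmin_geP; split=> [|i Pi]; rewrite ?leey// lee_fin; exact: F_ge.
split=> [ext|[[k Pk] <-]].
  by split; [have [[k]] := ext; exists k|exact: minE].
case: (@arg_minP _ _ _ k P F Pk) => l Pl F_ge.
have ext : is_extremum >=%R P F (F l) by split; [exists l|].
by rewrite (minE _ ext).
Qed.

End Extrema.

Theorem theorem3p1 (R : realType) (n : nat) (n_ge1 : (1 <= n)%N)
    (lam p : R) (lam01 : 0 <= lam <= 1) (p_neq0 : p != 0)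
    (A : 'M[R * R]_n) (A_ifm : is_ifm A)
    (m : nat) (m_ge1 : (1 <= m)%N) (i j : 'I_n) :
  ifm_pow lam p A m i j =
    (maxR (@is_mpath n m i j) (@weight_mu R lam p n m A),
     minR (@is_mpath n m i j) (@weight_nu R lam p n m A)).
Proof.
case: m m_ge1 => [//|m] _.
have mu01 s t : 0 <= (A s t).1 <= 1 by case: (A_ifm s t).
have nu01 s t : 0 <= (A s t).2 <= 1 by case: (A_ifm s t).
(* The new factor [A] stands on the right, matching a path extended by its last edge. *)
have powS k t : ifm_pow lam p A k.+2 i t =
  (maxR xpredT (fun s => gmean lam p (ifm_pow lam p A k.+1 i s).1 (A s t).1),
   minR xpredT (fun s => gmean lam p (ifm_pow lam p A k.+1 i s).2 (A s t).2)).
  by rewrite /ifm_pow/= mxE.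
rewrite [LHS]surjective_pairing; congr pair.
  suff /maxRP[_ ->] : is_extremum <=%R (@is_mpath n m.+1 i j)
    (@weight_mu R lam p n m.+1 A) (ifm_pow lam p A m.+1 i j).1 by [].
  apply: path_weight_extremum => //.
  refine (walk_weight_extremum lam01 mu01 (r := <=%R)
    (b := fun k t => (ifm_pow lam p A k.+1 i t).1) _ _ _ _ _ m j) => //.
  - by move=> x y z; exact: le_trans.
  - by move=> x y z; exact: le_gmean.
  (* The vertex [i] shows that there is an intermediate vertex to maximize over. *)
  - by move=> k t; rewrite powS; apply/(maxRP xpredT); split=> //; exists i.
suff /minRP[_ ->] : is_extremum >=%R (@is_mpath n m.+1 i j)
  (@weight_nu R lam p n m.+1 A) (ifm_pow lam p A m.+1 i j).2 by [].
apply: path_weight_extremum => //.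
refine (walk_weight_extremum lam01 nu01 (r := >=%R)
  (b := fun k t => (ifm_pow lam p A k.+1 i t).2) _ _ _ _ _ m j) => //.
- by move=> x; exact: lexx.
- by move=> x y z xy zx; exact: le_trans zx xy.
- by move=> x y z x01 y01 z01; exact: le_gmean.
- by move=> k t; rewrite powS; apply/(minRP xpredT); split=> //; exists i.
Qed.
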